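(* Let $k$ be a field, let $A$ be a unital associative $k$-algebra and let $M$ be a right $A$-module. Then $M$ admits a hom-connection with respect to the universal differential graded algebra over $A$ if and only if $M$ is an injective right $A$-module.
   Context: The universal differential graded algebra over $A$ is $(\Omega A,d)$, where $\Omega^1 A=\ker\mu$ with $\mu:A\otimes_k A\to A$ the multiplication map, $\Omega A=T_A(\Omega^1A)$ is the tensor algebra of the $A$-bimodule $\Omega^1A$, and $d:A\to\Omega^1A$, $a\mapsto 1\otimes a-a\otimes 1$, extended to $\Omega A$ by the graded Leibniz rule. A (right) hom-connection on a right $A$-module $M$ with respect to $(\Omega A,d)$ is a $k$-linear map $\nabla:\mathrm{Hom}_A(\Omega^1A,M)\to M$, where $\mathrm{Hom}_A$ denotes right $A$-module maps, such that $\nabla(fa)=\nabla(f)a+f(da)$ for all $f\in\mathrm{Hom}_A(\Omega^1A,M)$ and $a\in A$. Here $\mathrm{Hom}_A(\Omega^1A,M)$ is a right $A$-module by $(fa)(\omega)=f(a\omega)$. *)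

(* Defs.v *)
From HB Require Import structures.
From mathcomp Require Import all_boot all_algebra generic_quotient ring_quotient.
From mathcomp Require Import boolp.
From mathcomp.multinomials Require Import freeg.

Set Implicit Arguments.
Unset Strict Implicit.
Unset Printing Implicit Defensive.

Import GRing.Theory.
Local Open Scope ring_scope.
Local Open Scope quotient_scope.

Section Tensor.
Variables (k : fieldType) (V W : lmodType k).

Notation free := {freeg (V * W)%type / k}.
Notation gen v w := (<< (v, w) >> : free).

(* The submodule of the free k-module on V * W generated by the bilinearity
   relations. *)
Inductive tensor_rel : free -> Prop :=
| tensor_rel0 : tensor_rel 0
| tensor_rel_lin (c : k) x y :
    tensor_rel x -> tensor_rel y -> tensor_rel (c *: x + y)
| tensor_relDl v v' w : tensor_rel (gen (v + v') w - gen v w - gen v' w)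
| tensor_relDr v w w' : tensor_rel (gen v (w + w') - gen v w - gen v w')
| tensor_relZl c v w : tensor_rel (gen (c *: v) w - c *: gen v w)
| tensor_relZr c v w : tensor_rel (gen v (c *: w) - c *: gen v w).

Definition tensor_relb : {pred free} := fun x => `[< tensor_rel x >].

Lemma tensor_relb_closed : zmod_closed tensor_relb.
Proof.
split=> [|x y /asboolP rx /asboolP ry]; apply/asboolP; first exact: tensor_rel0.
by rewrite addrC -scaleN1r; exact: tensor_rel_lin.
Qed.

HB.instance Definition _ :=
  GRing.isZmodClosed.Build free tensor_relb tensor_relb_closed.

Definition tensor : Type := Quotient.quot tensor_relb.

HB.instance Definition _ := Quotient.on tensor.
HB.instance Definition _ := Choice.on tensor.
HB.instance Definition _ := EqQuotient.on tensor.
HB.instance Definition _ := GRing.Zmodule.on tensor.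
HB.instance Definition _ := ZmodQuotient.on tensor.

Let pi : free -> tensor := \pi_tensor.

Let piD x y : pi (x + y) = pi x + pi y.
Proof. exact: raddfD. Qed.

Let piB x y : pi (x - y) = pi x - pi y.
Proof. exact: raddfB. Qed.

Let pi_eq x y : tensor_rel (x - y) <-> pi x = pi y.
Proof.
split=> [rxy|/eqP]; last by rewrite -Quotient.idealrBE => /asboolP.
by apply/eqP; rewrite -Quotient.idealrBE; apply/asboolP.
Qed.

Definition tensor_scale (c : k) (t : tensor) : tensor := pi (c *: repr t).

Let pi_scale c x : tensor_scale c (pi x) = pi (c *: x).
Proof.
apply/pi_eq; rewrite -scalerBr -[_ *: _]addr0; apply: tensor_rel_lin.
  by apply/pi_eq; rewrite /pi reprK.
exact: tensor_rel0.
Qed.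

Let piP (P : tensor -> Prop) : (forall x, P (pi x)) -> forall t, P t.
Proof. by move=> Ppi t; rewrite -[t]reprK; exact: Ppi. Qed.

Lemma tensor_scaleA a b t :
  tensor_scale a (tensor_scale b t) = tensor_scale (a * b) t.
Proof. by elim/piP: t => x; rewrite !pi_scale scalerA. Qed.

Lemma tensor_scale1 : left_id 1 tensor_scale.
Proof. by elim/piP => x; rewrite pi_scale scale1r. Qed.

Lemma tensor_scaleDr : right_distributive tensor_scale +%R.
Proof.
move=> c; elim/piP => x; elim/piP => y.
by rewrite -piD !pi_scale scalerDr piD.
Qed.

Lemma tensor_scaleDl t : {morph tensor_scale^~ t : a b / a + b}.
Proof. by elim/piP: t => x a b; rewrite !pi_scale scalerDl piD. Qed.

HB.instance Definition _ := GRing.Zmodule_isLmodule.Build k tensor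
  tensor_scaleA tensor_scale1 tensor_scaleDr tensor_scaleDl.

Let piZ c x : pi (c *: x) = c *: pi x.
Proof. by rewrite -pi_scale. Qed.

Definition tens (v : V) (w : W) : tensor := pi (gen v w).

Fact tens_is_bilinear : bilinear_for *:%R *:%R tens.
Proof.
split=> [w c v v'|v c w w']; rewrite /= /tens -piZ -piD.
  transitivity (pi (gen (c *: v) w + gen v' w)); apply/pi_eq.
    by rewrite opprD addrA; exact: tensor_relDl.
  by rewrite opprD addrACA subrr addr0; exact: tensor_relZl.
transitivity (pi (gen v (c *: w) + gen v w')); apply/pi_eq.
  by rewrite opprD addrA; exact: tensor_relDr.
by rewrite opprD addrACA subrr addr0; exact: tensor_relZr.
Qed.

HB.instance Definition _ :=
  bilinear_isBilinear.Build k V W tensor *:%R *:%R tens tens_is_bilinear.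

Let free_ind (P : free -> Prop) :
    P 0 -> (forall c v w x, P x -> P (c *: gen v w + x)) -> forall x, P x.
Proof.
move=> P0 PD; elim/freeg_ind_dom0 => // c [v w] x _ _ Px.
suff -> : << c *g (v, w) >> = c *: gen v w by exact: PD.
by apply/eqP/freeg_eqP => y; rewrite coeffZ !coeffU mul1r.
Qed.

Lemma tensor_ind (P : tensor -> Prop) :
    P 0 -> (forall v w t, P t -> P (tens v w + t)) -> forall t, P t.
Proof.
move=> P0 PD; elim/piP; elim/free_ind => [|c v w x Px].
  by rewrite /pi raddf0.
by rewrite piD piZ -/(tens v w) -linearZl_LR; exact: PD.
Qed.

Section Lift.
Variables (U : lmodType k) (beta : {bilinear V -> W -> U}).

Let lift : free -> U := fglift (fun p : V * W => beta p.1 p.2).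

Definition tensor_lift (t : tensor) : U := lift (repr t).

Let liftB x y : lift (x - y) = lift x - lift y.
Proof. exact: lift_is_additive. Qed.

Let lift0 : lift 0 = 0.
Proof. by rewrite -[0 in LHS](subrr 0) liftB subrr. Qed.

Let liftD x y : lift (x + y) = lift x + lift y.
Proof.
have liftN z : lift (- z) = - lift z by rewrite -[- z]add0r liftB lift0 add0r.
by rewrite -[y in LHS]opprK liftB liftN opprK.
Qed.

Let lift_gen c v w : lift (c *: gen v w) = c *: beta v w.
Proof.
have -> : c *: gen v w = << c *g (v, w) >>.
  by apply/eqP/freeg_eqP => y; rewrite coeffZ !coeffU mul1r.
exact: liftU.
Qed.

Let lift_gen1 v w : lift (gen v w) = beta v w.
Proof. by rewrite -[gen v w]scale1r lift_gen scale1r. Qed.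

Let liftZ c x : lift (c *: x) = c *: lift x.
Proof.
elim/free_ind: x => [|a v w x IHx]; first by rewrite scaler0 lift0 scaler0.
by rewrite scalerDr !liftD IHx scalerA !lift_gen scalerDr scalerA.
Qed.

Let lift_rel x : tensor_rel x -> lift x = 0.
Proof.
elim=> [|c {}x y _ IHx _ IHy|v v' w|v w w'|c v w|c v w] //.
- by rewrite liftD liftZ IHx IHy scaler0 addr0.
- by rewrite !liftB !lift_gen1 linearDl addrAC addrK subrr.
- by rewrite !liftB !lift_gen1 linearDr addrAC addrK subrr.
- by rewrite !liftB lift_gen lift_gen1 linearZl_LR subrr.
- by rewrite !liftB lift_gen lift_gen1 linearZr_LR subrr.
Qed.

Let tensor_liftE x : tensor_lift (pi x) = lift x.
Proof.
apply/eqP; rewrite -subr_eq0 -liftB; apply/eqP/lift_rel/pi_eq.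
by rewrite /pi reprK.
Qed.

Lemma tensor_lift_tens v w : tensor_lift (tens v w) = beta v w.
Proof. by rewrite tensor_liftE lift_gen1. Qed.

Fact tensor_lift_is_linear : linear tensor_lift.
Proof.
move=> c; elim/piP => x; elim/piP => y.
by rewrite -piZ -piD !tensor_liftE liftD liftZ.
Qed.

HB.instance Definition _ :=
  GRing.isLinear.Build k tensor U *:%R tensor_lift tensor_lift_is_linear.

End Lift.
End Tensor.

Section Injective.
Variables (R : pzRingType) (M : lmodType R).

Definition injective_module : Prop :=
  forall (X Y : lmodType R) (i : {linear X -> Y}) (f : {linear X -> M}),
    injective i -> exists g : {linear Y -> M}, forall x, g (i x) = f x.

End Injective.

(* Right A-modules are left modules over the converse ring A^c. *)
Definition ract (A : pzRingType) (M : lmodType A^c) (m : M) (a : A) : M :=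
  (a : A^c) *: m.

Section UniversalCalculus.
Variables (k : fieldType) (A : algType k).

Notation AA := (tensor A A).

Definition alg_mul (a b : A) : A := a * b.

Fact alg_mul_is_bilinear : bilinear_for *:%R *:%R alg_mul.
Proof.
split=> [b c x y|a c x y]; rewrite /= /alg_mul; first by rewrite mulrDl scalerAl.
by rewrite mulrDr scalerAr.
Qed.

HB.instance Definition _ :=
  bilinear_isBilinear.Build k A A A *:%R *:%R alg_mul alg_mul_is_bilinear.

Definition tensor_mu : AA -> A := tensor_lift alg_mul.

HB.instance Definition _ := GRing.Linear.on tensor_mu.

Lemma tensor_muE a b : tensor_mu (tens a b) = a * b.
Proof. exact: tensor_lift_tens. Qed.

Definition tens_mull (a b c : A) : AA := tens (a * b) c.
Definition tens_mulr (a b c : A) : AA := tens b (c * a).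

Fact tens_mull_is_bilinear a : bilinear_for *:%R *:%R (tens_mull a).
Proof.
split=> [c e x y|b e x y]; rewrite /= /tens_mull; last by rewrite linearPr.
by rewrite mulrDr -scalerAr linearPl.
Qed.

Fact tens_mulr_is_bilinear a : bilinear_for *:%R *:%R (tens_mulr a).
Proof.
split=> [c e x y|b e x y]; rewrite /= /tens_mulr; first by rewrite linearPl.
by rewrite mulrDl -scalerAl linearPr.
Qed.

HB.instance Definition _ a := bilinear_isBilinear.Build k A A AA
  *:%R *:%R (tens_mull a) (tens_mull_is_bilinear a).
HB.instance Definition _ a := bilinear_isBilinear.Build k A A AA
  *:%R *:%R (tens_mulr a) (tens_mulr_is_bilinear a).

(* The A-bimodule structure on the tensor square, extending
   a (b (x) c) = (a b) (x) c and (b (x) c) a = b (x) (c a). *)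
Definition tensor_lact (a : A) : AA -> AA := tensor_lift (tens_mull a).
Definition tensor_ract (a : A) : AA -> AA := tensor_lift (tens_mulr a).

HB.instance Definition _ a := GRing.Linear.on (tensor_lact a).
HB.instance Definition _ a := GRing.Linear.on (tensor_ract a).

Lemma tensor_lactE a b c : tensor_lact a (tens b c) = tens (a * b) c.
Proof. exact: tensor_lift_tens. Qed.

Lemma tensor_ractE a b c : tensor_ract a (tens b c) = tens b (c * a).
Proof. exact: tensor_lift_tens. Qed.

Lemma tensor_mu_lact a t : tensor_mu (tensor_lact a t) = a * tensor_mu t.
Proof.
elim/tensor_ind: t => [|b c t IHt]; first by rewrite !linear0 mulr0.
by rewrite !linearD /= IHt tensor_lactE !tensor_muE mulrDr mulrA.
Qed.

Lemma tensor_mu_ract a t : tensor_mu (tensor_ract a t) = tensor_mu t * a.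
Proof.
elim/tensor_ind: t => [|b c t IHt]; first by rewrite !linear0 mul0r.
by rewrite !linearD /= IHt tensor_ractE !tensor_muE mulrDl mulrA.
Qed.

Definition ker_mu : {pred AA} := fun t => tensor_mu t == 0.

Fact ker_mu_closed : zmod_closed ker_mu.
Proof.
split=> [|t u /eqP t0 /eqP u0]; apply/eqP; first exact: linear0.
by rewrite linearB /= t0 u0 subr0.
Qed.

HB.instance Definition _ := GRing.isZmodClosed.Build AA ker_mu ker_mu_closed.

Record omega1 : Type := Omega1 { omega1_val : AA; _ : omega1_val \in ker_mu }.

HB.instance Definition _ := [isSub for omega1_val].
HB.instance Definition _ := [Choice of omega1 by <:].
HB.instance Definition _ := [SubChoice_isSubZmodule of omega1 by <:].

Fact tensor_lact_ker a (w : omega1) : tensor_lact a (val w) \in ker_mu.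
Proof.
by apply/eqP; rewrite tensor_mu_lact (eqP (valP w : tensor_mu _ == 0)) mulr0.
Qed.

Fact tensor_ract_ker a (w : omega1) : tensor_ract a (val w) \in ker_mu.
Proof.
by apply/eqP; rewrite tensor_mu_ract (eqP (valP w : tensor_mu _ == 0)) mul0r.
Qed.

Definition omega1_lact (a : A) (w : omega1) : omega1 :=
  Omega1 (tensor_lact_ker a w).
Definition omega1_scale (a : A^c) (w : omega1) : omega1 :=
  Omega1 (tensor_ract_ker a w).

Fact omega1_scaleA a b w :
  omega1_scale a (omega1_scale b w) = omega1_scale (a * b) w.
Proof.
apply: val_inj => /=; elim/tensor_ind: (omega1_val w) => [|x y t IHt].
  by rewrite !linear0.
by rewrite !linearD /= IHt !tensor_ractE mulrA.
Qed.

Fact omega1_scale1 : left_id 1 omega1_scale.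
Proof.
move=> w; apply: val_inj => /=.
elim/tensor_ind: (omega1_val w) => [|x y t IHt]; first by rewrite linear0.
by rewrite linearD /= IHt tensor_ractE mulr1.
Qed.

Fact omega1_scaleDr : right_distributive omega1_scale +%R.
Proof. by move=> a w w'; apply: val_inj; rewrite /= linearD. Qed.

Fact omega1_scaleDl w : {morph omega1_scale^~ w : a b / a + b}.
Proof.
move=> a b; apply: val_inj => /=.
elim/tensor_ind: (omega1_val w) => [|x y t IHt].
  by rewrite !linear0 addr0.
by rewrite !linearD /= IHt !tensor_ractE mulrDr linearDr addrACA.
Qed.

HB.instance Definition _ := GRing.Zmodule_isLmodule.Build A^c omega1
  omega1_scaleA omega1_scale1 omega1_scaleDr omega1_scaleDl.

Lemma omega1_lact_ract a b (w : omega1) :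
  ract (omega1_lact a w) b = omega1_lact a (ract w b).
Proof.
apply: val_inj => /=; elim/tensor_ind: (omega1_val w) => [|x y t IHt].
  by rewrite !linear0.
by rewrite !linearD /= IHt !(tensor_lactE, tensor_ractE).
Qed.

Fact univ_d_ker a : tens 1 a - tens a 1 \in ker_mu.
Proof. by apply/eqP; rewrite linearB /= !tensor_muE mul1r mulr1 subrr. Qed.

Definition univ_d (a : A) : omega1 := Omega1 (univ_d_ker a).

Lemma univ_dM a b : univ_d (a * b) = ract (univ_d a) b + omega1_lact a (univ_d b).
Proof.
apply: val_inj; rewrite /= !linearB /= !(tensor_lactE, tensor_ractE).
by rewrite !mul1r mulr1 addrA subrK.
Qed.

Section HomConnection.
Variable M : lmodType A^c.

(* The right action (f a)(w) = f (a w) on the right A-linear maps. *)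
Definition hom_ract (f : {linear omega1 -> M}) (a : A) : omega1 -> M :=
  fun w => f (omega1_lact a w).

Fact hom_ract_is_linear f a : linear (hom_ract f a).
Proof.
move=> b w w'; rewrite /hom_ract -linearP; congr (f _).
rewrite -[b *: w]/(ract w b) -[b *: _]/(ract _ (b : A)) omega1_lact_ract.
by apply: val_inj; rewrite /= linearD.
Qed.

HB.instance Definition _ f a :=
  GRing.isLinear.Build A^c omega1 M *:%R (hom_ract f a) (hom_ract_is_linear f a).

(* The k-linear structure on a right A-module is c m = m (c 1). *)
Definition kscale (c : k) (m : M) : M := ract m (c%:A : A).

Definition hom_kscale (c : k) (f : {linear omega1 -> M}) : omega1 -> M :=
  fun w => kscale c (f w).

Fact hom_kscale_is_linear c f : linear (hom_kscale c f).
Proof.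
move=> b w w'; rewrite /hom_kscale /kscale /ract linearP scalerDr !scalerA.
congr (_ *: f w + _); change ((b : A) * c%:A = c%:A * (b : A)).
by rewrite -scalerAr -scalerAl mulr1 mul1r.
Qed.

HB.instance Definition _ c f := GRing.isLinear.Build A^c omega1 M *:%R
  (hom_kscale c f) (hom_kscale_is_linear c f).

Record is_hom_connection (nabla : {linear omega1 -> M} -> M) : Prop := {
  hom_connectionD : forall f g : {linear omega1 -> M},
    nabla (f \+ g) = nabla f + nabla g;
  hom_connectionZ : forall c f, nabla (hom_kscale c f) = kscale c (nabla f);
  hom_connectionM : forall f a,
    nabla (hom_ract f a) = ract (nabla f) a + f (univ_d a)
}.

End HomConnection.
End UniversalCalculus.

(* Main.v *)
Require Import Defs.
From HB Require Import structures.
From mathcomp Require Import all_boot all_algebra.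
From mathcomp Require Import boolp classical_sets functions.
Import GRing.Theory.
Local Open Scope ring_scope.

(** A right A-module M embeds in the coinduced module Hom_k(A, M), on which A
    acts by (phi a)(b) = phi (a b), by sending m to the map b |-> m b; call this
    embedding the unit. Everything rests on two facts.

    First, M is injective if and only if the unit has an A-linear retraction r.
    If M is injective, the identity of M extends along the unit. Conversely, let
    r be a retraction, i : X -> Y an injective A-linear map and f : X -> M an
    A-linear map. As k is a field, i has a k-linear retraction p
    (linear_retraction), so f p extends f to a k-linear map on Y. Then
    y |-> (b |-> f (p (y b))) is an A-linear map from Y to Hom_k(A, M), whose
    composite with r extends f (retraction_injective).

    Second, retractions of the unit correspond to hom-connections. A right
    A-linear map on A (x) A is determined by its restriction to A (x) 1, so
    Hom_A(A (x) A, M) is Hom_k(A, M), and the exact sequence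
    0 -> Omega^1 A -> A (x) A -> A -> 0 induces
    0 -> M -> Hom_k(A, M) -> Hom_A(Omega^1 A, M) -> 0,
    whose first map is the unit. The second map sends phi to the restriction of
    a (x) b |-> phi(a) b, and is split k-linearly by f |-> - f d. This splitting
    fails to be A-linear by exactly the unit of the term f (d a) in the rule
    for hom-connections (coind_d_ract): hence r yields the hom-connection
    f |-> r (- f d) (retraction_hom_connection), and a hom-connection nabla
    yields the retraction phi |-> phi 1 + nabla (phi on Omega^1 A)
    (hom_connection_retraction). *)

Set Implicit Arguments.
Unset Strict Implicit.
Unset Printing Implicit Defensive.

(** * Linear algebra over a field *)

(** A complement S of the range of i is a maximal subset that is closed under
    the maps c *: s + t and meets the range only in 0; the retraction is then
    the projection along S. *)
Lemma linear_retraction (k : fieldType) (X Y : lmodType k)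
    (i : {linear X -> Y}) :
  injective i -> exists p : {linear Y -> X}, cancel i p.
Proof.
move=> inj_i.
(* The empty set is admissible, as the union of the empty chain has to be. *)
pose P (S : set Y) := (forall c s t, S s -> S t -> S (c *: s + t)) /\
  (forall x, S (i x) -> x = 0).
have [F FP totF|S [[Slin Sker] Smax]] := @Zorn_bigcup Y P.
  split=> [c s t [U FU Us] [V FV Vt]|x [U FU Uix]]; last first.
    by have [_] := FP _ FU; apply.
  have [UV|VU] := totF _ _ FU FV.
    by exists V => //; have [lin _] := FP _ FV; apply: lin => //; exact: UV.
  by exists U => //; have [lin _] := FP _ FU; apply: lin => //; exact: VU.
have S0 : S 0.
  apply: contrapT => nS0.
  have Se s : ~ S s.
    by move=> Ss; apply: nS0; rewrite -[0](addNr s) -scaleN1r; apply: Slin.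
  apply: (Smax [set 0]%classic).
    by split=> [s /Se|/(_ 0 erefl)].
  split=> [c s t -> ->|x /= ix0]; first by rewrite /= scaler0 addr0.
  by apply: inj_i; rewrite linear0.
have SZ c s : S s -> S (c *: s).
  by move=> Ss; rewrite -[_ *: _]addr0; apply: Slin.
have decomp y : exists x, S (y - i x).
  apply: contrapT => ndec.
  apply: (Smax [set c *: y + s | c in setT & s in S]%classic).
    split=> [s Ss|BS].
      by exists 0 => //; exists s => //; rewrite scale0r add0r.
    apply: ndec; exists 0; rewrite linear0 subr0; apply: BS.
    by exists 1 => //; exists 0 => //; rewrite scale1r addr0.
  split=> [c _ _ [a _ [s Ss <-]] [b _ [t St <-]]|x [c _ [s Ss ysx]]].
    exists (c * a + b) => //; exists (c *: s + t); first exact: Slin.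
    by rewrite scalerDl scalerDr scalerA addrACA.
  have [c0|c0] := eqVneq c 0.
    by apply: Sker; rewrite -ysx c0 scale0r add0r.
  case: ndec; exists (c^-1 *: x).
  rewrite linearZ /= -ysx scalerDr scalerA mulVf // scale1r opprD addrA subrr.
  by rewrite add0r -scaleNr; apply: SZ.
pose p y := sval (cid (decomp y)).
have pP y : S (y - i (p y)) by rewrite /p; case: cid.
have p_uniq y x : S (y - i x) -> p y = x.
  move=> Syx; apply/eqP; rewrite -subr_eq0; apply/eqP/Sker.
  have -> : i (p y - x) = -1 *: (y - i (p y)) + (y - i x).
    by rewrite linearB /= scaleN1r opprB addrA subrK.
  exact: Slin.
have p_lin : linear p.
  move=> c y z; apply: p_uniq.
  have -> : c *: y + z - i (c *: p y + p z) =
            c *: (y - i (p y)) + (z - i (p z)).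
    by rewrite linearP /= scalerBr opprD addrACA.
  exact: Slin.
pose pM := GRing.isLinear.Build k Y X *:%R p p_lin.
pose pL : {linear Y -> X} := HB.pack p pM.
by exists pL => x; apply: p_uniq; rewrite subrr.
Qed.

(** A hom-connection is a function on bundled linear maps, so moving an equation
    between maps through it requires equality of the bundles. *)
Lemma linear_ext (R : pzRingType) (X Y : lmodType R) (f g : {linear X -> Y}) :
  f =1 g -> f = g.
Proof.
move=> /funext.
case: f g => f [[f1] [f2]] [g [[g1] [g2]]] /= fg.
by case: _ / fg in g1 g2 *; congr (GRing.Linear.Pack (GRing.Linear.Class _ _));
  congr (_ _); apply: Prop_irrelevance.
Qed.

(** * Restriction of scalars and coinduction *)

Section Coinduction.
Variables (k : fieldType) (A : algType k).

Section Restriction.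
Variable M : lmodType A^c.

(** An alias, so that the k-module structure does not compete with the
    A-module structure on the same carrier. *)
Definition scalar_restriction : Type := M.

HB.instance Definition _ := GRing.Zmodule.on scalar_restriction.

Let kscaleA (a b : k) (m : scalar_restriction) :
  kscale a (kscale b m) = kscale (a * b) m.
Proof.
rewrite /kscale /ract scalerA; congr (_ *: m).
by change ((b%:A : A) * a%:A = (a * b)%:A); rewrite mulr_algl scalerA mulrC.
Qed.

Let kscale1 : left_id 1 (@kscale k A M).
Proof. by move=> m; rewrite /kscale /ract scale1r; exact: scale1r. Qed.

Let kscaleDr : right_distributive (@kscale k A M) +%R.
Proof. by move=> c m n; exact: scalerDr. Qed.

Let kscaleDl m : {morph (@kscale k A M)^~ m : a b / a + b}.
Proof. by move=> a b; rewrite /kscale /ract scalerDl; exact: scalerDl. Qed.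

HB.instance Definition _ := GRing.Zmodule_isLmodule.Build k scalar_restriction
  kscaleA kscale1 kscaleDr kscaleDl.

End Restriction.

Lemma kscale_ract (M : lmodType A^c) (c : k) (m : M) (a : A) :
  ract (kscale c m) a = kscale c (ract m a).
Proof.
rewrite /kscale /ract !scalerA; congr (_ *: m).
by change (c%:A * a = a * c%:A); rewrite mulr_algl mulr_algr.
Qed.

Lemma ract_linear (M : lmodType A^c) (m : M) :
  linear (ract m : A -> scalar_restriction M).
Proof.
move=> c x y; rewrite /ract scalerDl; congr (_ + _).
rewrite -[RHS]/(ract (ract m x) (c%:A : A)) /ract scalerA; congr (_ *: m).
by change (c *: (x : A) = (x : A) * c%:A); rewrite mulr_algr.
Qed.

Definition scalar_restriction_map (M N : lmodType A^c) (f : {linear M -> N}) :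
  scalar_restriction M -> scalar_restriction N := f.

Fact scalar_restriction_map_linear (M N : lmodType A^c)
    (f : {linear M -> N}) :
  linear (scalar_restriction_map f).
Proof.
move=> c x y; rewrite /scalar_restriction_map linearD; congr (_ + _).
exact: (linearZ_LR f (c%:A : A) x).
Qed.

HB.instance Definition _ (M N : lmodType A^c) (f : {linear M -> N}) :=
  GRing.isLinear.Build k (scalar_restriction M) (scalar_restriction N) *:%R
    (scalar_restriction_map f) (scalar_restriction_map_linear f).

Variable M : lmodType A^c.

Definition klinear : {pred A -> scalar_restriction M} :=
  fun phi => `[< linear phi >].

Fact klinear_closed : zmod_closed klinear.
Proof.
split=> [|f g /asboolP lf /asboolP lg]; apply/asboolP=> c x y.
  by rewrite /= scaler0 addr0.
rewrite -[LHS]/(f _ - g _) lf lg -[(f - g) x]/(f x - g x).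
by rewrite -[(f - g) y]/(f y - g y) scalerBr opprD addrACA.
Qed.

HB.instance Definition _ :=
  GRing.isZmodClosed.Build (A -> scalar_restriction M) klinear klinear_closed.

Record coinduced : Type :=
  Coinduced { coind_val : A -> scalar_restriction M;
              _ : coind_val \in klinear }.

HB.instance Definition _ := [isSub for coind_val].
HB.instance Definition _ := [Choice of coinduced by <:].
HB.instance Definition _ := [SubChoice_isSubZmodule of coinduced by <:].

Lemma coind_linear (phi : coinduced) : linear (coind_val phi).
Proof. by apply/asboolP; exact: valP phi. Qed.

HB.instance Definition _ phi := GRing.isLinear.Build k A (scalar_restriction M)
  *:%R (coind_val phi) (coind_linear phi).

Definition coind (phi : A -> M)
    (phi_lin : linear (phi : A -> scalar_restriction M)) : coinduced :=
  Coinduced (introT (asboolP _) phi_lin : _ \in klinear).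

Lemma coind_ext (phi psi : coinduced) :
  coind_val phi =1 coind_val psi -> phi = psi.
Proof. by move=> e; apply: val_inj; exact: funext. Qed.

Lemma coind_valD (phi psi : coinduced) a :
  coind_val (phi + psi) a = coind_val phi a + coind_val psi a.
Proof. by []. Qed.

Fact coind_act_linear (a : A) (phi : coinduced) :
  linear (fun b => coind_val phi (a * b)).
Proof. by move=> c x y; rewrite mulrDr -scalerAr linearP. Qed.

Definition coind_act (a : A^c) (phi : coinduced) : coinduced :=
  coind (coind_act_linear a phi).

Fact coind_actA a b phi : coind_act a (coind_act b phi) = coind_act (a * b) phi.
Proof. by apply: coind_ext => x; rewrite /= mulrA. Qed.

Fact coind_act1 : left_id 1 coind_act.
Proof. by move=> phi; apply: coind_ext => x; rewrite /= mul1r. Qed.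

Fact coind_actDr : right_distributive coind_act +%R.
Proof. by move=> a phi psi; apply: coind_ext. Qed.

Fact coind_actDl phi : {morph coind_act^~ phi : a b / a + b}.
Proof.
by move=> a b; apply: coind_ext => x; rewrite coind_valD /= mulrDl linearD.
Qed.

HB.instance Definition _ := GRing.Zmodule_isLmodule.Build A^c coinduced
  coind_actA coind_act1 coind_actDr coind_actDl.

Lemma coind_val_ract (phi : coinduced) (a b : A) :
  coind_val (ract phi a) b = coind_val phi (a * b).
Proof. by []. Qed.

Definition coind_unit (m : M) : coinduced := coind (ract_linear m).

Fact coind_unit_linear : linear coind_unit.
Proof.
move=> a m n; apply: coind_ext => b; rewrite coind_valD /= /ract scalerDr.
by rewrite scalerA.
Qed.

HB.instance Definition _ := GRing.isLinear.Build A^c M coinduced *:%R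
  coind_unit coind_unit_linear.

Lemma coind_unit_inj : injective coind_unit.
Proof.
by move=> m n /(congr1 (coind_val^~ 1)) /=; rewrite /ract !scale1r.
Qed.

(** The adjunction between restriction of scalars and coinduction turns the
    k-linear extension of a map into an A-linear one with values in the
    coinduced module, and the retraction brings it back to M. *)
Lemma retraction_injective (r : {linear coinduced -> M}) :
  cancel coind_unit r -> injective_module M.
Proof.
move=> rK X Y i f inj_i.
have [p pK] := linear_retraction (inj_i : injective (scalar_restriction_map i)).
have g_lin (y : Y) :
    linear (fun b : A => scalar_restriction_map f (p (ract y b))).
  by move=> c x z; rewrite ract_linear !linearP.
pose g (y : Y) := r (coind (g_lin y)).
have gL : linear g.
  move=> a y z; rewrite /g -linearP; congr (r _).
  apply: coind_ext => b; rewrite coind_valD /=.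
  have -> : ract (a *: y + z) b = (ract y ((a : A) * b) : scalar_restriction Y)
                                  + (ract z b : scalar_restriction Y).
    by rewrite /ract scalerDr scalerA.
  by rewrite !linearD.
pose gM := GRing.isLinear.Build A^c Y M *:%R g gL.
exists (HB.pack g gM : {linear Y -> M}) => x /=.
rewrite -[RHS]rK /g; congr (r _); apply: coind_ext => b /=.
have -> : ract (i x) b = scalar_restriction_map i (ract x b).
  by rewrite /ract -linearZ_LR.
by rewrite pK /=; rewrite -[LHS]/(f ((b : A^c) *: x)) linearZ_LR.
Qed.

(** * Retractions and hom-connections *)

Definition coind_pair (phi : coinduced) (a b : A) : scalar_restriction M :=
  ract (coind_val phi a) b.

Fact coind_pair_is_bilinear phi : bilinear_for *:%R *:%R (coind_pair phi).
Proof.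
split=> [b c x y|a c x y]; last exact: ract_linear.
rewrite /= /coind_pair linearP /ract scalerDr; congr (_ + _).
exact: kscale_ract.
Qed.

HB.instance Definition _ phi := bilinear_isBilinear.Build k A A
  (scalar_restriction M) *:%R *:%R
  (coind_pair phi) (coind_pair_is_bilinear phi).

Definition coind_omega (phi : coinduced) (w : omega1 A) : M :=
  tensor_lift (coind_pair phi) (val w).

Fact coind_omega_linear phi : linear (coind_omega phi).
Proof.
move=> a w v; rewrite /coind_omega /= linearD; congr (_ + _).
elim/tensor_ind: (omega1_val w) => [|x y t IHt].
  by rewrite !linear0 scaler0.
rewrite !linearD /= IHt scalerDr tensor_ractE !tensor_lift_tens; congr (_ + _).
by rewrite /coind_pair /ract scalerA.
Qed.

HB.instance Definition _ phi := GRing.isLinear.Build A^c (omega1 A) M *:%R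
  (coind_omega phi) (coind_omega_linear phi).

Lemma coind_omegaD phi psi w :
  coind_omega (phi + psi) w = coind_omega phi w + coind_omega psi w.
Proof.
rewrite /coind_omega /=; elim/tensor_ind: (omega1_val w) => [|x y t IHt].
  by rewrite !linear0 addr0.
rewrite !linearD /= IHt !tensor_lift_tens addrACA; congr (_ + _).
by rewrite /coind_pair /ract -scalerDr.
Qed.

Lemma coind_omega_ract phi a :
  coind_omega (ract phi a) =1 hom_ract (coind_omega phi) a.
Proof.
move=> w; rewrite /= /hom_ract /coind_omega /=.
elim/tensor_ind: (omega1_val w) => [|x y t IHt]; first by rewrite !linear0.
by rewrite !linearD /= IHt tensor_lactE !tensor_lift_tens.
Qed.

(** On coind_unit m, the lifted map is t |-> m (mu t), which vanishes on the
    kernel of mu. *)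
Lemma coind_omega_unit m w : coind_omega (coind_unit m) w = 0.
Proof.
transitivity (ract m (tensor_mu (val w))); last first.
  by rewrite (eqP (valP w : tensor_mu _ == 0)) /ract scale0r.
rewrite /coind_omega /=; elim/tensor_ind: (omega1_val w) => [|x y t IHt].
  by rewrite !linear0 /ract scale0r.
rewrite !linearD /= IHt tensor_lift_tens tensor_muE /ract scalerDl.
congr (_ + _); exact: (scalerA (y : A^c) (x : A^c) m).
Qed.

Lemma coind_omega_d phi a :
  coind_omega phi (univ_d a) = ract (coind_val phi 1) a - coind_val phi a.
Proof.
rewrite /coind_omega /= linearB /= !tensor_lift_tens; congr (_ - _).
exact: scale1r.
Qed.

(** Evaluation at 1 sends the product of phi by a to phi(a), not to phi(1) a. The
    difference phi(1) a - phi(a) is the value at d a of the map on Omega^1 A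
    attached to phi (coind_omega_d), hence the extra term in the rule for nabla,
    so that the sum of the two is A-linear. *)
Lemma hom_connection_retraction (nabla : {linear omega1 A -> M} -> M) :
  is_hom_connection nabla ->
  exists r : {linear coinduced -> M}, cancel coind_unit r.
Proof.
case=> nablaD _ nablaM.
pose r phi := coind_val phi 1 + nabla (coind_omega phi).
have rL : linear r.
  move=> a phi psi; rewrite /r.
  have -> : coind_omega (a *: phi + psi) =
            (hom_ract (coind_omega phi) a \+ coind_omega psi)
              :> {linear omega1 A -> M}.
    by apply: linear_ext => w /=; rewrite coind_omegaD coind_omega_ract.
  rewrite coind_valD (coind_val_ract phi a) mulr1 nablaD nablaM /=.
  rewrite coind_omega_d /ract scalerDr addrACA; congr (_ + _).
  by rewrite addrC -addrA subrK addrC.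
have nabla0 : nabla (coind_omega 0) = 0.
  apply: (addrI (nabla (coind_omega 0))); rewrite addr0 -nablaD.
  by congr nabla; apply: linear_ext => w /=; rewrite -coind_omegaD addr0.
pose rM := GRing.isLinear.Build A^c coinduced M *:%R r rL.
exists (HB.pack r rM : {linear coinduced -> M}) => m /=.
rewrite /r /= /ract scale1r -[RHS]addr0 -nabla0; congr (_ + nabla _).
by apply: linear_ext => w /=; rewrite coind_omega_unit -(linear0 coind_unit)
  coind_omega_unit.
Qed.

Lemma univ_d_linear (c : k) (a b : A) :
  univ_d (c *: a + b) = ract (univ_d a) c%:A + univ_d b.
Proof.
apply: val_inj; rewrite /= linearB /= !tensor_ractE mul1r mulr_algr.
by rewrite linearPr linearPl !linearZr_LR /= opprD addrACA.
Qed.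

Fact coind_d_linear (f : {linear omega1 A -> M}) :
  linear (fun a : A => - f (univ_d a) : scalar_restriction M).
Proof.
move=> c a b; rewrite univ_d_linear linearD opprD; congr (_ + _).
by rewrite /ract linearZ_LR -scalerN.
Qed.

Definition coind_d f : coinduced := coind (coind_d_linear f).

Lemma coind_d_ract (f : {linear omega1 A -> M}) a :
  coind_d (hom_ract f a) = ract (coind_d f) a + coind_unit (f (univ_d a)).
Proof.
apply: coind_ext => b; rewrite coind_valD /= univ_dM linearD opprD.
by rewrite /hom_ract addrAC /ract linearZ_LR addNr add0r.
Qed.

(** The Leibniz rule is coind_d_ract pushed through r, since r sends the unit of
    f (d a) back to f (d a). *)
Lemma retraction_hom_connection (r : {linear coinduced -> M}) :
  cancel coind_unit r -> is_hom_connection (r \o coind_d).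
Proof.
move=> rK; split=> [f g|c f|f a] /=.
- by rewrite -linearD; congr (r _); apply: coind_ext => a; rewrite coind_valD /=
    opprD.
- rewrite -[RHS]linearZ_LR; congr (r _); apply: coind_ext => a.
  rewrite coind_val_ract mulr_algl linearZ_LR /= /hom_kscale.
  exact: (esym (scalerN _ _)).
by rewrite coind_d_ract linearD rK; congr (_ + _); exact: linearZ_LR.
Qed.

End Coinduction.

Theorem theorem2p2 (k : fieldType) (A : algType k) (M : lmodType A^c) :
  (exists nabla : {linear omega1 A -> M} -> M, is_hom_connection nabla) <->
  injective_module M.
Proof.
split=> [[nabla /hom_connection_retraction[r rK]]|injM].
  exact: retraction_injective rK.
have [r rK] := injM _ _ (coind_unit (M := M)) idfun (@coind_unit_inj k A M).
by exists (r \o coind_d (M := M)); exact: retraction_hom_connection.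
Qed.
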